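(* Let $\Delta$ be a simplicial complex and let $\sigma=\{u_{\tau_1},\dots,u_{\tau_r}\}$ be a nonempty face of the barycentric subdivision $\mathcal{B}(\Delta)$, for some nonempty faces $\tau_1\subsetneq\dots\subsetneq\tau_r$ of $\Delta$. There is an isomorphism of simplicial complexes $$\mathrm{link}_{\mathcal{B}(\Delta)}\sigma\cong\mathcal{B}(\mathrm{link}_\Delta\tau_r)\ast\mathcal{B}(\mathrm{link}_{\partial\tau_r}\tau_{r-1})\ast\dots\ast\mathcal{B}(\mathrm{link}_{\partial\tau_2}\tau_1)\ast\mathcal{B}(\partial\tau_1).$$
   Context: Simplicial complexes are finite sets of subsets of a finite vertex set closed under taking subsets. The barycentric subdivision $\mathcal{B}(\Delta)$ of $\Delta$ is the complex on vertex set $\{u_\sigma:\sigma\in\Delta\setminus\{\emptyset\}\}$ whose faces are the sets $\{u_{\sigma_1},\dots,u_{\sigma_r}\}$ with $\sigma_1\subsetneq\dots\subsetneq\sigma_r$ (including the empty face, so $\mathcal{B}(\{\emptyset\})=\{\emptyset\}$). For a face $\sigma$ of $\Delta$, $\mathrm{link}_\Delta\sigma=\{\tau\in\Delta:\sigma\cap\tau=\emptyset,\sigma\cup\tau\in\Delta\}$. For a finite set $\tau$, $\partial\tau$ denotes the boundary of the simplex on $\tau$, i.e. the complex of all proper subsets of $\tau$. For complexes on disjoint vertex sets, the join is $A\ast B=\{\alpha\sqcup\beta:\alpha\in A,\beta\in B\}$ (vertex sets are made disjoint if necessary). *)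

(* Defs.v *)
From mathcomp Require Import all_boot.

Set Implicit Arguments.
Unset Strict Implicit.
Unset Printing Implicit Defensive.

(* Elements of [ground] need not be vertices: [v] is a vertex of [K] when
   [[set v]] is a face.  No face is required, so [faces] may be [set0] (the
   void complex), which differs from [[set set0]]. *)
Record scomplex := SComplex {
  ground : finType;
  faces : {set {set ground}};
  faces_closed : forall s t : {set ground},
    s \in faces -> t \subset s -> t \in faces }.

Definition vertices (K : scomplex) : {set ground K} :=
  [set v | [set v] \in faces K].

(* Ground elements that are not vertices play no role. *)
Definition scomplex_iso (A B : scomplex) : Prop :=
  exists f : {v | v \in vertices A} -> {w | w \in vertices B},
    bijective f /\
    forall s : {set {v | v \in vertices A}},
      ([set val v | v in s] \in faces A) =
      ([set val (f v) | v in s] \in faces B).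

Section Link.
Variables (K : scomplex) (s : {set ground K}).

Definition link_faces : {set {set ground K}} :=
  [set t in faces K | (s :&: t == set0) && (s :|: t \in faces K)].

Lemma link_closed (t u : {set ground K}) :
  t \in link_faces -> u \subset t -> u \in link_faces.
Proof.
rewrite !inE => /and3P[tK /eqP st0 stK] ut.
rewrite (faces_closed tK ut) -subset0 -st0 setIS //=.
by apply: faces_closed stK _; rewrite setUS.
Qed.

Definition link : scomplex := SComplex link_closed.
End Link.
Arguments link K s : clear implicits.

Section Boundary.
Variables (V : finType) (t : {set V}).

Definition boundary_faces : {set {set V}} :=
  [set s : {set V} | s \proper t].

Lemma boundary_closed (s u : {set V}) :
  s \in boundary_faces -> u \subset s -> u \in boundary_faces.
Proof. by rewrite !inE => st us; apply: sub_proper_trans us st. Qed.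

Definition boundary : scomplex := SComplex boundary_closed.
End Boundary.

Section Barycentric.
Variable K : scomplex.

(* The vertex u_s is encoded by the nonempty face s itself. *)
Definition barycentric_faces : {set {set {set ground K}}} :=
  [set F : {set {set ground K}} | (F \subset faces K :\ set0) &&
    [forall s in F, forall t in F, (s \subset t) || (t \subset s)]].

Lemma barycentric_closed (F G : {set {set ground K}}) :
  F \in barycentric_faces -> G \subset F -> G \in barycentric_faces.
Proof.
rewrite !inE => /andP[FK /forall_inP Fc] GF.
rewrite (subset_trans GF FK); apply/forall_inP => s sG; apply/forall_inP => t tG.
exact: (forall_inP (Fc s (subsetP GF s sG))) t (subsetP GF t tG).
Qed.

Definition barycentric : scomplex := SComplex barycentric_closed.

Lemma barycentricP (F : {set {set ground K}}) :
  reflect (exists c : seq {set ground K},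
             [/\ {in c, forall s, s \in faces K /\ s != set0},
                 sorted (fun s t : {set ground K} => s \proper t) c & F = [set s in c]])
          (F \in faces barycentric).
Proof.
rewrite inE; apply: (iffP andP) => [[/subsetP FK /forall_inP Fc]|[c [cK cs ->]]].
  pose leC (s t : {set ground K}) := #|s| <= #|t|.
  have memc : sort leC (enum F) =i F.
    by move=> x; rewrite mem_sort mem_enum.
  exists (sort leC (enum F)); split.
  - by move=> s; rewrite memc => /FK; rewrite !inE => /andP[-> ->].
  - have leCs : sorted leC (sort leC (enum F)).
      by apply: sort_sorted => s t; apply: leq_total.
    have uc : uniq (sort leC (enum F)) by rewrite sort_uniq enum_uniq.
    rewrite sorted_pairwise; last by move=> ? ? ?; apply: proper_trans.
    have: pairwise leC (sort leC (enum F)).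
      by rewrite -sorted_pairwise // => ? ? ?; apply: leq_trans.
    elim: (sort _ _) memc uc {leCs} => [|x c IH] //.
    move=> memc.
    have : {subset x :: c <= F} by move=> y; rewrite memc.
    move: {memc IH} (x :: c) => {x}c cF uc pc.
    elim: c cF uc pc => [|x c IH] //= cF /andP[xc uc] /andP[xlt pc].
    rewrite IH ?andbT // => [|y yc]; last by apply: cF; rewrite inE yc orbT.
    apply/allP => y yc; have /allP/(_ y yc) xy := xlt.
    have xF : x \in F by apply: cF; rewrite inE eqxx.
    have yF : y \in F by apply: cF; rewrite inE yc orbT.
    have xNy : x != y by apply: contraNneq xc => ->.
    rewrite properEneq xNy /=.
    case/orP: (forall_inP (Fc x xF) y yF) => // yx.
    by move: xNy; rewrite eq_sym eqEcard yx (xy : #|x| <= #|y|).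
  - by apply/setP => x; rewrite inE memc.
split.
  by apply/subsetP => s; rewrite !inE => /cK[-> ->].
have pw : pairwise (fun s t : {set ground K} => s \proper t) c.
  by rewrite -sorted_pairwise // => ? ? ?; apply: proper_trans.
apply/forall_inP => s; rewrite inE => sc; apply/forall_inP => t; rewrite inE => tc.
elim: c {cK cs} pw sc tc => //= x c IH /andP[/allP xc pc].
rewrite !inE => /predU1P[->|sc] /predU1P[->|tc]; rewrite ?subxx //.
- by rewrite (proper_sub (xc _ tc)).
- by rewrite (proper_sub (xc _ sc)) orbT.
- exact: IH.
Qed.
End Barycentric.

Section Join.
Variables A B : scomplex.

Definition join_faces : {set {set ground A + ground B}} :=
  [set [set inl x | x in a] :|: [set inr y | y in b]
     | a : {set ground A} in faces A, b : {set ground B} in faces B].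

Lemma join_closed (s t : {set ground A + ground B}) :
  s \in join_faces -> t \subset s -> t \in join_faces.
Proof.
case/imset2P => a b aA bB -> /subsetP tab.
apply/imset2P; exists (inl @^-1: t) (inr @^-1: t).
- apply: faces_closed aA _; apply/subsetP => x; rewrite inE => /tab.
  by rewrite inE => /orP[] /imsetP[y yb // [->]].
- apply: faces_closed bB _; apply/subsetP => x; rewrite inE => /tab.
  by rewrite inE => /orP[] /imsetP[y yb // [->]].
apply/setP => -[x|y]; rewrite inE.
- rewrite mem_imset ?inE; last by move=> ? ? [].
  by case: imsetP => [[]|]; rewrite ?orbF.
- rewrite [X in _ || X]mem_imset ?inE; last by move=> ? ? [].
  by case: imsetP => [[]|].
Qed.

Definition join : scomplex := SComplex join_closed.
End Join.

(* Main.v *)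
Require Import Defs.
From mathcomp Require Import all_boot.

(** Both sides are order complexes, that is, complexes of inclusion chains.  The
vertices of the link of [sigma] are the nonempty faces of [Delta] that are
comparable to, and different from, every [tau i]; they split into the intervals
above [tau r], strictly between [tau i] and [tau i.+1], and below [tau 1], and
members of different intervals are always comparable.  So the complex of chains
is the join of those of the intervals, and [x |-> tau i :|: x] identifies each
interval with the nonempty faces of a link. *)

Set Implicit Arguments.
Unset Strict Implicit.
Unset Printing Implicit Defensive.

(** * Chains of sets under inclusion *)

Definition comparable_sets (T : finType) (x y : {set T}) : bool :=
  (x \subset y) || (y \subset x).

Definition is_chain (T : finType) (C : {set {set T}}) : bool :=
  [forall x in C, forall y in C, comparable_sets x y].

Lemma is_chainP (T : finType) (C : {set {set T}}) :
  reflect {in C &, forall x y, comparable_sets x y} (is_chain C).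
Proof.
apply: (iffP forall_inP) => [cC x y xC yC|cC x xC].
  exact: (forall_inP (cC x xC)).
by apply/forall_inP => y yC; apply: cC.
Qed.

Lemma is_chain0 (T : finType) : is_chain (set0 : {set {set T}}).
Proof. by apply/is_chainP => x y; rewrite inE. Qed.

Lemma is_chain1 (T : finType) (x : {set T}) : is_chain [set x].
Proof.
by apply/is_chainP => y z /set1P-> /set1P->; rewrite /comparable_sets subxx.
Qed.

Lemma comparable_setsC (T : finType) (x y : {set T}) :
  comparable_sets x y = comparable_sets y x.
Proof. exact: orbC. Qed.

(** This is what turns unions of families into joins: mixed pairs are comparable by hypothesis, so
    only pairs within [C] or within [D] remain to be tested. *)
Lemma is_chainU (T : finType) (C D : {set {set T}}) :
  {in C & D, forall x y, comparable_sets x y} ->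
  is_chain (C :|: D) = is_chain C && is_chain D.
Proof.
move=> cCD; apply/is_chainP/andP => [cU|[/is_chainP cC /is_chainP cD] x y].
  by split; apply/is_chainP => x y xC yC; apply: cU; rewrite inE ?xC ?yC ?orbT.
case/setUP=> xC /setUP[] yC; [exact: cC | exact: cCD | | exact: cD].
by rewrite comparable_setsC cCD.
Qed.

(** * Complexes modelled by the chains of a family of sets *)

(** An isomorphism of [K] with the order complex of [P] under inclusion. The conditions bear on
    vertices only, because a map such as [x |-> t :|: x] is injective on the faces of the link of
    [t] but in general not on all sets. *)
Definition chain_model (T : finType) (K : scomplex) (P : {set {set T}}) : Prop :=
  exists g : ground K -> {set T},
    [/\ {in vertices K &, injective g},
        g @: vertices K = P &
        forall s : {set ground K}, s \subset vertices K ->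
          (s \in faces K) = is_chain (g @: s)].

(** The isomorphism is the inverse of [h] after [g]: both are bijections from the vertices onto the
    same [P], and being a face depends only on the image in [P]. *)
Lemma chain_model_iso (T : finType) (A B : scomplex) (P : {set {set T}}) :
  chain_model A P -> chain_model B P -> scomplex_iso A B.
Proof.
move=> [g [gI gP gF]] [h [hI hP hF]].
have exf (v : {v | v \in vertices A}) :
    exists w : {w | w \in vertices B}, h (val w) == g (val v).
  have : g (val v) \in h @: vertices B by rewrite hP -gP imset_f ?(valP v).
  by case/imsetP=> w wB ->; exists (exist _ w wB).
have exf' (w : {w | w \in vertices B}) :
    exists v : {v | v \in vertices A}, g (val v) == h (val w).
  have : h (val w) \in g @: vertices A by rewrite gP -hP imset_f ?(valP w).
  by case/imsetP=> v vA ->; exists (exist _ v vA).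
have fE v : h (val (xchoose (exf v))) = g (val v) by apply/eqP/(xchooseP (exf v)).
have fE' w : g (val (xchoose (exf' w))) = h (val w) by apply/eqP/(xchooseP (exf' w)).
exists (fun v => xchoose (exf v)); split.
  exists (fun w => xchoose (exf' w)) => [v|w]; apply: val_inj => /=.
    by apply: gI; [exact: valP|exact: valP|rewrite fE' fE].
  by apply: hI; [exact: valP|exact: valP|rewrite fE fE'].
move=> s; rewrite gF ?hF.
- by rewrite -!imset_comp; congr is_chain; apply: eq_imset => v /=; rewrite fE.
- by apply/subsetP => _ /imsetP[v _ ->]; apply: valP.
- by apply/subsetP => _ /imsetP[v _ ->]; apply: valP.
Qed.

Lemma mem_join (A B : scomplex) (s : {set ground (join A B)}) :
  (s \in faces (join A B)) =
    (inl @^-1: s \in faces A) && (inr @^-1: s \in faces B).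
Proof.
have sE (a : {set ground A}) (b : {set ground B})
    (u := [set inl x | x in a] :|: [set inr y | y in b]) :
    inl @^-1: u = a /\ inr @^-1: u = b.
  split; apply/setP => x; rewrite !inE.
    rewrite mem_imset; last by move=> ? ? [].
    by case: imsetP => [[]|]; rewrite ?orbF.
  rewrite [X in _ || X]mem_imset; last by move=> ? ? [].
  by case: imsetP => [[]|].
apply/imset2P/andP => [[a b aA bB ->]|[sA sB]].
  by have [-> ->] := sE a b.
exists (inl @^-1: s) (inr @^-1: s) => //.
apply/setP => -[x|y]; rewrite inE.
- rewrite mem_imset ?inE; last by move=> ? ? [].
  by case: imsetP => [[]|]; rewrite ?orbF.
- rewrite [X in _ || X]mem_imset ?inE; last by move=> ? ? [].
  by case: imsetP => [[]|].
Qed.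

(** Disjointness of [P] and [Q] makes the combined map injective; comparability across them makes a
    union of two chains a chain. *)
Lemma chain_model_join (T : finType) (A B : scomplex) (P Q : {set {set T}}) :
  [disjoint P & Q] -> {in P & Q, forall x y, comparable_sets x y} ->
  chain_model A P -> chain_model B Q -> chain_model (join A B) (P :|: Q).
Proof.
move=> dPQ cPQ [g [gI gP gF]] [h [hI hQ hF]].
(* A vertex of one factor is a vertex of the join only if it can be paired with the empty face of
   the other. The empty set is a face of both factors because it is a chain. *)
have A0 : set0 \in faces A by rewrite gF ?sub0set // imset0 is_chain0.
have B0 : set0 \in faces B by rewrite hF ?sub0set // imset0 is_chain0.
have Vl x : (inl x \in vertices (join A B)) = (x \in vertices A).
  rewrite inE mem_join [RHS]inE.
  have -> : inl @^-1: [set (inl x : ground (join A B))] = [set x] :> {set ground A}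
    by apply/setP => y; rewrite !inE.
  have -> : inr @^-1: [set (inl x : ground (join A B))] = set0 :> {set ground B}.
    by apply/setP => y; rewrite !inE.
  by rewrite B0 andbT.
have Vr y : (inr y \in vertices (join A B)) = (y \in vertices B).
  rewrite inE mem_join [RHS]inE.
  have -> : inr @^-1: [set (inr y : ground (join A B))] = [set y] :> {set ground B}
    by apply/setP => x; rewrite !inE.
  have -> : inl @^-1: [set (inr y : ground (join A B))] = set0 :> {set ground A}.
    by apply/setP => x; rewrite !inE.
  by rewrite A0.
pose k (z : ground (join A B)) :=
  match z with inl x => g x | inr y => h y end.
have kE (s : {set ground (join A B)}) :
    k @: s = g @: (inl @^-1: s) :|: h @: (inr @^-1: s).
  apply/setP => z; apply/imsetP/setUP.
    case=> -[x|y] zs ->; [left|right]; apply/imsetP.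
      by exists x; rewrite ?inE.
    by exists y; rewrite ?inE.
  by case=> /imsetP[x]; rewrite inE => xs ->; [exists (inl x)|exists (inr x)].
have gVP x : x \in vertices A -> g x \in P by move=> xA; rewrite -gP imset_f.
have hVQ y : y \in vertices B -> h y \in Q by move=> yB; rewrite -hQ imset_f.
exists k; split.
- move=> [x|x] [y|y]; rewrite ?Vl ?Vr => xV yV /= xy.
  + by rewrite (gI _ _ xV yV xy).
  + by have := disjointFr dPQ (gVP _ xV); rewrite xy hVQ.
  + by have := disjointFr dPQ (gVP _ yV); rewrite -xy hVQ.
  + by rewrite (hI _ _ xV yV xy).
- rewrite kE -gP -hQ.
  have -> : inl @^-1: vertices (join A B) = vertices A.
    by apply/setP => x; rewrite -Vl inE.
  have -> // : inr @^-1: vertices (join A B) = vertices B.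
  by apply/setP => y; rewrite -Vr inE.
- move=> s /subsetP sV.
  have sA : inl @^-1: s \subset vertices A.
    by apply/subsetP => x; rewrite inE -Vl => /sV.
  have sB : inr @^-1: s \subset vertices B.
    by apply/subsetP => x; rewrite inE -Vr => /sV.
  rewrite kE is_chainU ?mem_join ?gF ?hF //.
  move=> _ _ /imsetP[x xs ->] /imsetP[y ys ->]; apply: cPQ.
    exact/gVP/(subsetP sA).
  exact/hVQ/(subsetP sB).
Qed.

(** * Models of barycentric subdivisions and of their links *)

Lemma mem_barycentric (K : scomplex) (F : {set {set ground K}}) :
  (F \in faces (barycentric K)) = (F \subset faces K :\ set0) && is_chain F.
Proof. by rewrite inE. Qed.

Lemma vertices_barycentric (K : scomplex) :
  vertices (barycentric K) = faces K :\ set0.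
Proof.
by apply/setP => x; rewrite inE mem_barycentric is_chain1 andbT sub1set.
Qed.

(** An order embedding of the faces preserves and reflects comparability, and antisymmetry of
    inclusion makes it injective. *)
Lemma chain_model_barycentric (T : finType) (K : scomplex)
    (g : {set ground K} -> {set T}) :
  {in faces K &, forall x y, (g x \subset g y) = (x \subset y)} ->
  chain_model (barycentric K) (g @: (faces K :\ set0)).
Proof.
move=> gS; exists g; rewrite vertices_barycentric; split=> //.
  move=> x y /setD1P[_ xK] /setD1P[_ yK] gxy; apply/eqP.
  by rewrite eqEsubset -!gS // gxy subxx.
move=> s sK; rewrite mem_barycentric sK /=.
have sF x : x \in s -> x \in faces K by move/(subsetP sK)/setD1P=> [].
apply/is_chainP/is_chainP => [cs _ _ /imsetP[x xs ->] /imsetP[y ys ->]|cs x y xs ys].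
  by rewrite /comparable_sets !gS ?sF //; apply: cs.
by have := cs _ _ (imset_f g xs) (imset_f g ys); rewrite /comparable_sets !gS ?sF.
Qed.

(** Faces of the link are disjoint from [t], so removing [t] inverts [x |-> t :|: x]; nonempty faces
    correspond to proper supersets of [t]. *)
Lemma chain_model_barycentric_link (K : scomplex) (t : {set ground K}) :
  chain_model (barycentric (link K t)) [set x in faces K | t \proper x].
Proof.
have disj (x : {set ground K}) : x \in faces (link K t) -> t :&: x = set0.
  by rewrite inE => /and3P[_ /eqP].
have UK (x : {set ground K}) : t :&: x = set0 -> (t :|: x) :\: t = x.
  by move=> tx; rewrite setDUl setDv set0U; apply/setDidPl; rewrite -setI_eq0 setIC tx.
rewrite (_ : [set x in _ | _] = (fun x => t :|: x) @: (faces (link K t) :\ set0)).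
  apply: chain_model_barycentric => x y xL yL.
  apply/idP/idP => [xy|]; last exact: setUS.
  by rewrite -(UK x (disj x xL)) -(UK y (disj y yL)) setSD.
apply/setP => x; rewrite !inE; apply/andP/imsetP => [[xK tx]|[y]].
  have xE : t :|: x :\: t = x by rewrite setDE setUIr setUCr setIT; apply/setUidPr/proper_sub.
  exists (x :\: t) => //; rewrite !inE xE xK setIDA setDIl setDv set0I eqxx.
  rewrite (faces_closed xK (subsetDl _ _)) !andbT setD_eq0.
  by move: tx; rewrite properE => /andP[].
rewrite !inE => /and4P[y0 yK /eqP ty tyK] ->; split=> //.
(* If [t :|: y] were inside [t], then [y] would equal [t :&: y], which is empty. *)
rewrite properE subsetUl subUset subxx /=; apply: contra y0 => yt.
by rewrite -ty; apply/eqP/esym/setIidPr.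
Qed.

Lemma chain_model_barycentric_boundary (V : finType) (t : {set V}) :
  chain_model (barycentric (boundary t)) [set x | (x != set0) && (x \proper t)].
Proof.
rewrite (_ : [set x | _] = id @: (faces (boundary t) :\ set0)).
  exact: chain_model_barycentric.
by rewrite imset_id; apply/setP => x; rewrite !inE.
Qed.

(** Being a chain is a condition on pairs, so whether a chain [s] lies in the link can be tested on
    one member at a time. The inequalities [x != y] express that [s] is disjoint from [F]. *)
Lemma chain_model_link_barycentric (K : scomplex) (F : {set {set ground K}}) :
  F \in faces (barycentric K) ->
  chain_model (link (barycentric K) F)
    [set x in faces K :\ set0 | [forall y in F, (x != y) && comparable_sets x y]].
Proof.
set P := [set x in _ | _]; rewrite mem_barycentric => /andP[FK cF].
have linkE (s : {set {set ground K}}) :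
    (s \in faces (link (barycentric K) F)) = (s \subset P) && is_chain s.
  rewrite inE !mem_barycentric.
  apply/and3P/andP => [[/andP[sK cs] /eqP Fs0 /andP[_ cU]]|[/subsetP sP cs]].
    split=> //; apply/subsetP => x xs.
    rewrite inE (subsetP sK) //=; apply/forall_inP => y yF; apply/andP; split.
      apply/eqP => xy; have : x \in F :&: s by rewrite inE xs xy yF.
      by rewrite Fs0 inE.
    by apply: (is_chainP _ cU); rewrite inE ?xs ?yF ?orbT.
  have sK : s \subset faces K :\ set0 by apply/subsetP => x /sP; rewrite inE => /andP[].
  have cFs x y : x \in s -> y \in F -> (x != y) && comparable_sets x y.
    by move=> /sP; rewrite inE => /andP[_ /forall_inP]; apply.
  split; first by rewrite sK.
    apply/set0Pn => -[x /setIP[xF xs]].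
    by have := cFs x x xs xF; rewrite eqxx.
  rewrite subUset FK sK is_chainU ?cF //= => x y xF ys.
  by rewrite comparable_setsC; case/andP: (cFs y x ys xF).
have VE : vertices (link (barycentric K) F) = P.
  by apply/setP => x; rewrite inE linkE is_chain1 andbT sub1set.
exists id; rewrite VE; split=> // [|s sP]; first exact: imset_id.
by rewrite imset_id linkE sP.
Qed.

(** * Gluing the intervals along the chain *)

(** The fold runs downwards: the accumulator models the part of [P] above [tau m.+1], and each join
    adds the open interval just below it. Hence the induction on [m] with [A] general. *)
Lemma chain_model_foldl_join (Delta : scomplex) (P : {set {set ground Delta}})
    (tau : nat -> {set ground Delta}) (m : nat) (A : scomplex) :
  (forall i, 1 <= i <= m -> tau i \proper tau i.+1) ->
  (forall i (x : {set ground Delta}), 1 <= i <= m ->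
     tau i \proper x -> x \proper tau i.+1 -> x \in P) ->
  (forall i (x : {set ground Delta}), 1 <= i <= m -> x \in P ->
     (x != tau i.+1) && comparable_sets x (tau i.+1)) ->
  chain_model A [set x in P | tau m.+1 \proper x] ->
  chain_model
    (foldl join A [seq barycentric (link (boundary (tau i.+1)) (tau i)) | i <- rev (iota 1 m)])
    [set x in P | tau 1 \proper x].
Proof.
elim: m A => [|m IH] A //= htau hin hcmp hA.
(* The last index [m.+1] is split off; after reversal it is the first to be joined to [A]. *)
rewrite -[1 :: _]/(iota 1 m.+1) -{1}[m.+1]addn1 iotaD rev_cat add1n /=.
have mle : 1 <= m.+1 <= m.+1 by rewrite leqnn.
have mono i : 1 <= i <= m -> 1 <= i <= m.+1 by case/andP=> -> /leqW.
apply: IH => [i /mono|i x /mono|i x /mono|]; [exact: htau|exact: hin|exact: hcmp|].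
rewrite (_ : [set x in P | tau m.+1 \proper x] =
  [set x in P | tau m.+2 \proper x] :|:
  [set x in faces (boundary (tau m.+2)) | tau m.+1 \proper x]).
  apply: chain_model_join (chain_model_barycentric_link _) => //.
    rewrite -setI_eq0; apply/set0Pn => -[x]; rewrite !inE.
    case/and3P=> /andP[_ tx] xt _.
    by have := proper_trans tx xt; rewrite properxx.
  move=> x y; rewrite !inE => /andP[_ /proper_sub tx] /andP[/proper_sub yt _].
  by rewrite /comparable_sets (subset_trans yt tx) orbT.
apply/setP => x; rewrite !inE; apply/andP/orP => [[xP tx]|[/andP[xP tx]|/andP[xt tx]]].
(* Being comparable to [tau m.+2] and different from it, [x] lies strictly above it or in the
   interval just below it. *)
- have /andP[xne /orP[xt|tx']] := hcmp _ _ mle xP.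
    by right; rewrite tx properEneq xne xt.
  by left; rewrite xP properEneq eq_sym xne tx'.
- by split=> //; apply: proper_trans tx; apply: htau.
- by split=> //; apply: (hin m.+1).
Qed.

Theorem proposition6p27 (Delta : scomplex)
    (sigma : {set ground (barycentric Delta)})
    (hsigma : sigma \in faces (barycentric Delta))
    (hsigma0 : sigma != set0)
    (r : nat) (tau : nat -> {set ground Delta})
    (htau : forall i : nat, 1 <= i <= r ->
       tau i \in faces Delta /\ tau i != set0)
    (hchain : forall i : nat, 1 <= i < r -> tau i \proper tau i.+1)
    (hsigma_tau : sigma = [set s in [seq tau i | i <- iota 1 r]]) :
  scomplex_iso
    (link (barycentric Delta) sigma)
    (foldl join (barycentric (link Delta (tau r)))
       (rcons [seq barycentric (link (boundary (tau i.+1)) (tau i))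
                 | i <- rev (iota 1 r.-1)]
              (barycentric (boundary (tau 1))))).
Proof.
(* With [r = 0] the face [sigma] would be empty; from here on the largest set is [tau r.+1]. *)
case: r => [|r] in htau hchain hsigma_tau *.
  by case/eqP: hsigma0; rewrite hsigma_tau; apply/setP => x; rewrite !inE.
apply: chain_model_iso (chain_model_link_barycentric hsigma) _.
set P := [set x in _ | _].
have mono i j : 1 <= i -> i <= j <= r.+1 -> tau i \subset tau j.
  move=> i1; elim: j => [|j IH] /andP[]; first by rewrite leqn0 => /eqP->.
  rewrite leq_eqVlt => /predU1P[-> //|ij] jr.
  apply: subset_trans (IH _) (proper_sub (hchain _ _)).
    by rewrite -ltnS ij ltnW.
  by rewrite jr andbT (leq_trans i1).
have PE (x : {set ground Delta}) : reflect [/\ x \in faces Delta, x != set0 &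
    forall i, 1 <= i <= r.+1 -> (x != tau i) && comparable_sets x (tau i)] (x \in P).
  rewrite inE; apply: (iffP andP) => [[/setD1P[x0 xD] /forall_inP xs]|[xD x0 xs]].
    split=> // i ir; apply: xs; rewrite hsigma_tau inE map_f //.
    by rewrite mem_iota.
  rewrite in_setD1 x0; split=> //; apply/forall_inP => y.
  rewrite hsigma_tau inE => /mapP[i]; rewrite mem_iota => ir ->; exact: xs.
(* Position relative to one [tau i] settles comparability with a whole end of the chain: with all
   later sets here, with all earlier ones in [above]. *)
have below (x : {set ground Delta}) i : x \proper tau i -> 1 <= i <= r.+1 ->
    forall j, i <= j <= r.+1 -> (x != tau j) && comparable_sets x (tau j).
  move=> xi /andP[i1 _] j /(mono _ _ i1) ij.
  have := proper_sub_trans xi ij.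
  by rewrite /comparable_sets properEneq => /andP[-> ->].
have above (x : {set ground Delta}) i : tau i \proper x -> i <= r.+1 ->
    forall j, 1 <= j <= i -> (x != tau j) && comparable_sets x (tau j).
  move=> xi ir j /andP[j1 ji].
  have := sub_proper_trans (mono j i j1 _) xi; rewrite ji ir => /(_ isT).
  by rewrite /comparable_sets properEneq eq_sym => /andP[-> ->]; rewrite orbT.
have nz (x : {set ground Delta}) i : tau i \proper x -> x != set0.
  by move=> ix; rewrite -proper0 (sub_proper_trans (sub0set (tau i)) ix).
(* The factor for the boundary of [tau 1] is joined last, so it is peeled off first, and [P] is cut
   at [tau 1] to match. *)
rewrite -cats1 foldl_cat /=.
rewrite (_ : P = [set x in P | tau 1 \proper x] :|:
                 [set x | (x != set0) && (x \proper tau 1)]); last first.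
  apply/setP => x; rewrite in_setU in_set [x \in [set x | _ && (_ \proper _)]]inE.
  apply/idP/orP => [xP|[/andP[] //|/andP[x0 x1]]].
    have /PE[xD x0 /(_ 1 isT)/andP[xne /orP[xt|tx]]] := xP.
      by right; rewrite x0 properEneq xne.
    by left; rewrite xP properEneq eq_sym xne.
  apply/PE; split=> //; last exact: below x1 _.
  by apply: faces_closed (proper_sub x1); case: (htau 1).
apply: chain_model_join; last exact: chain_model_barycentric_boundary.
- rewrite -setI_eq0; apply/set0Pn => -[x].
  rewrite in_setI in_set [x \in [set x | _ && (_ \proper _)]]inE.
  case/and3P=> /andP[_ tx] _ xt.
  by have := proper_trans tx xt; rewrite properxx.
- move=> x y; rewrite in_set [y \in _]inE => /andP[_ /proper_sub tx] /andP[_ /proper_sub yt].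
  by rewrite /comparable_sets (subset_trans yt tx) orbT.
apply: chain_model_foldl_join => [i ir|i x /andP[i1 ir] ix xi|i x /andP[i1 ir] /PE[_ _]|].
- exact: hchain.
- have iS : 1 <= i.+1 <= r.+1 by [].
  apply/PE; split.
  + by apply: faces_closed (proper_sub xi); case: (htau _ iS).
  + exact: nz ix.
  (* For [x] strictly between [tau i] and [tau i.+1], indices up to [i] are handled by [above] and
     the others by [below]. *)
  move=> j /andP[j1 jr]; case: (leqP j i) => ji.
    by apply: (above x i ix (leqW ir)); rewrite j1.
  by apply: (below x i.+1 xi iS); rewrite ji.
- by apply; rewrite ltnS.
(* The initial accumulator: a face strictly above the largest set of the chain is automatically
   nonempty, comparable to every [tau j] and different from it. *)
rewrite (_ : [set x in P | _] = [set x in faces Delta | tau r.+1 \proper x]).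
  exact: chain_model_barycentric_link.
apply/setP => x; rewrite in_set [RHS]in_set.
apply/andP/andP => [[/PE[xD _ _] tx]|[xD tx]]; split=> //.
by apply/PE; split=> //; [exact: nz tx | exact: above tx _].
Qed.
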